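(* The following identities of formal power series in $q$ hold: $$\sum_{n=0}^{\infty}RD_3^{3,27}(3n+2)q^n=9\left(\frac{E_3}{E_1}\right)^9\left(\frac{E_9}{E_{27}}\right)^3,$$ and $$\sum_{n=0}^{\infty}RD_3^{3,27}(9n+2)q^n=\sum_{i=1}^{3}y_{2,i}\,q^{i-1}\frac{E_3^{3(4i-2)}}{E_9^{3(4i-2)}}\left(\frac{E_9^3}{E_1^3}\right)^{4i-3},$$ where $y_2=(y_{2,1},y_{2,2},y_{2,3},\ldots)=(3^2,\,3^7,\,3^{10},\,0,\,0,\ldots)$.
   Context: For $r\ge1$, $E_r=\prod_{n=1}^{\infty}(1-q^{nr})$, $|q|<1$ (or as a formal power series in $q$). For positive integers $\ell,t,k$, $RD_k^{\ell,t}(n)$ denotes the number of partitions of $n$ in which each part carries one of $k$ colors, no part is divisible by $\ell$, and each colored part appears fewer than $t$ times; its generating function is $$\sum_{n=0}^{\infty}RD_k^{\ell,t}(n)q^n=\left(\frac{E_\ell E_t}{E_1E_{\ell t}}\right)^k.$$ In particular $\sum_{n\ge0}RD_3^{3,27}(n)q^n=\left(\frac{E_3E_{27}}{E_1E_{81}}\right)^3$. *)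

(* Defs.v *)
From HB Require Import structures.
From mathcomp Require Import all_boot all_order all_algebra.
From mathcomp Require Import boolp.

Set Implicit Arguments.
Unset Strict Implicit.
Unset Printing Implicit Defensive.

Import GRing.Theory.
Local Open Scope ring_scope.

(* The coefficient function is wrapped in a record so that the Cauchy product
   does not clash with the pointwise ring structure on functions. *)
Record fps (R : Type) := Fps { fcoef : nat -> R }.

Notation "{ 'fps' R }" := (fps R) (at level 0, format "{ 'fps'  R }") : type_scope.

HB.instance Definition _ (R : Type) := gen_eqMixin (fps R).
HB.instance Definition _ (R : Type) := gen_choiceMixin (fps R).

Lemma fpsP (R : Type) (f g : {fps R}) : (forall n, fcoef f n = fcoef g n) <-> f = g.
Proof.
split=> [|-> //]; case: f g => [f] [g] /= efg.
by congr Fps; apply/funext.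
Qed.

Section FpsRing.
Variable R : comUnitRingType.
Implicit Types f g h : {fps R}.

Definition fps_zero : {fps R} := Fps (fun=> 0).
Definition fps_opp f : {fps R} := Fps (fun n => - fcoef f n).
Definition fps_add f g : {fps R} := Fps (fun n => fcoef f n + fcoef g n).
Definition fps_one : {fps R} := Fps (fun n => (n == 0)%:R).
Definition fps_mul f g : {fps R} :=
  Fps (fun n => \sum_(i < n.+1) fcoef f i * fcoef g (n - i)).

Fact fps_addA : associative fps_add.
Proof. by move=> f g h; apply/fpsP => n /=; rewrite addrA. Qed.
Fact fps_addC : commutative fps_add.
Proof. by move=> f g; apply/fpsP => n /=; rewrite addrC. Qed.
Fact fps_add0 : left_id fps_zero fps_add.
Proof. by move=> f; apply/fpsP => n /=; rewrite add0r. Qed.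
Fact fps_addN : left_inverse fps_zero fps_opp fps_add.
Proof. by move=> f; apply/fpsP => n /=; rewrite addNr. Qed.

HB.instance Definition _ :=
  GRing.isZmodule.Build {fps R} fps_addA fps_addC fps_add0 fps_addN.

Definition trunc N f : {poly R} := \poly_(i < N) fcoef f i.

Lemma fps_mul_trunc N f g n : (n < N)%N ->
  fcoef (fps_mul f g) n = (trunc N f * trunc N g)`_n.
Proof.
move=> ltnN; rewrite coefM; apply: eq_bigr => i _; rewrite !coef_poly.
rewrite (leq_ltn_trans _ ltnN); last by rewrite -ltnS.
by rewrite (leq_ltn_trans _ ltnN) ?leq_subr.
Qed.

Fact fps_mulC : commutative fps_mul.
Proof.
by move=> f g; apply/fpsP => n; rewrite !(@fps_mul_trunc n.+1) // mulrC.
Qed.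

Fact fps_mulA : associative fps_mul.
Proof.
move=> f g h; apply/fpsP => n; rewrite [LHS]/= [RHS]/=.
transitivity ((trunc n.+1 f * (trunc n.+1 g * trunc n.+1 h))`_n).
  rewrite coefM; apply: eq_bigr => i _.
  rewrite -[\sum_(_ < _) _]/(fcoef (fps_mul g h) (n - i)).
  rewrite (@fps_mul_trunc n.+1) ?ltnS ?leq_subr //.
  by rewrite [X in _ = X * _]coef_poly ltn_ord.
rewrite mulrA coefM; apply: eq_bigr => i _.
rewrite -[\sum_(_ < _) _ in RHS]/(fcoef (fps_mul f g) i).
rewrite (@fps_mul_trunc n.+1) //.
by rewrite [X in _ * X = _]coef_poly ltnS leq_subr.
Qed.

Fact fps_mul1 : left_id fps_one fps_mul.
Proof.
move=> f; apply/fpsP => n /=; rewrite big_ord_recl /= mul1r subn0 big1 ?addr0 //.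
by move=> i _; rewrite mul0r.
Qed.

Fact fps_mulDl : left_distributive fps_mul fps_add.
Proof.
move=> f g h; apply/fpsP => n /=; rewrite -big_split /=.
by apply: eq_bigr => i _; rewrite mulrDl.
Qed.

Fact fps_oneN0 : fps_one != 0.
Proof. by apply/eqP => /fpsP/(_ 0)/eqP; rewrite /= oner_eq0. Qed.

HB.instance Definition _ :=
  GRing.Zmodule_isComNzRing.Build {fps R}
    fps_mulA fps_mulC fps_mul1 fps_mulDl fps_oneN0.

(* The first n coefficients of the inverse of f, obtained by solving
   \sum_(i <= m) g_i * f_(m - i) = (m == 0) for g_m. *)
Fixpoint fps_inv_seq f n : seq R :=
  if n is m.+1 then
    let s := fps_inv_seq f m in
    rcons s (((m == 0)%:R - \sum_(i < m) s`_i * fcoef f (m - i)) / fcoef f 0)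
  else [::].

Definition fps_unit : pred {fps R} := fun f => fcoef f 0 \is a GRing.unit.
Definition fps_inv f : {fps R} :=
  if fps_unit f then Fps (fun n => (fps_inv_seq f n.+1)`_n) else f.

Lemma size_fps_inv_seq f n : size (fps_inv_seq f n) = n.
Proof. by elim: n => //= n IHn; rewrite size_rcons IHn. Qed.

Lemma nth_fps_inv_seq f n i : (i < n)%N ->
  (fps_inv_seq f n)`_i = (fps_inv_seq f i.+1)`_i.
Proof.
elim: n => // n IHn; rewrite ltnS leq_eqVlt => /predU1P[-> //|ltin].
by rewrite [LHS]/= nth_rcons size_fps_inv_seq ltin IHn.
Qed.

Fact fps_mulV : {in fps_unit, left_inverse 1 fps_inv *%R}.
Proof.
move=> f; rewrite /in_mem /= /fps_inv => uf; rewrite uf.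
apply/fpsP => n /=; rewrite big_ord_recr subnn /=.
rewrite nth_rcons size_fps_inv_seq ltnn eqxx divrK //.
rewrite addrC -addrA -[RHS]addr0; congr (_ + _).
apply/eqP; rewrite addrC subr_eq0; apply/eqP/eq_bigr => i _.
rewrite -[rcons _ _]/(fps_inv_seq f i.+1).
by rewrite [in RHS]nth_fps_inv_seq.
Qed.

Fact fps_unitPl f g : g * f = 1 -> fps_unit f.
Proof.
move=> /fpsP/(_ 0); rewrite /= big_ord1 subnn => e.
by apply/unitrPr; exists (fcoef g 0); rewrite mulrC.
Qed.

Fact fps_inv_out : {in [predC fps_unit], fps_inv =1 id}.
Proof. by move=> f; rewrite inE /in_mem /= /fps_inv => /negPf->. Qed.

HB.instance Definition _ :=
  GRing.ComNzRing_hasMulInverse.Build {fps R} fps_mulV fps_unitPl fps_inv_out.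

Lemma fps_unitE f : (f \is a GRing.unit) = (fcoef f 0 \is a GRing.unit).
Proof. by []. Qed.

End FpsRing.

Definition fpsX (R : comUnitRingType) : {fps R} := Fps (fun n => (n == 1)%:R).
Notation "''q'" := (fpsX _) (at level 0) : ring_scope.

(* E r is the infinite product of the 1 - q^(m r), m >= 1. For r > 0 the factors
   with m > n do not affect the coefficient of q^n: see [fcoef_E]. *)
Definition E (r : nat) : {fps int} :=
  Fps (fun n => (\prod_(1 <= m < n.+1) (1 - 'X^(m * r)) : {poly int})`_n).

Lemma fcoef_E r n N : (0 < r)%N -> (n <= N)%N ->
  fcoef (E r) n = (\prod_(1 <= m < N.+1) (1 - 'X^(m * r)) : {poly int})`_n.
Proof.
move=> r_gt0; elim: N => [|N IHN]; first by rewrite leqn0 => /eqP->.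
rewrite leq_eqVlt => /predU1P[-> //|]; rewrite ltnS => lenN.
rewrite big_nat_recr //= mulrBr mulr1 coefB coefMXn.
by rewrite (leq_trans _ (leq_pmulr N.+1 r_gt0)) ?ltnS // subr0 -IHN.
Qed.

Lemma unit_E r : E r \is a GRing.unit.
Proof. by rewrite fps_unitE /= big_nil coef1. Qed.

(* A k-colored partition of n is encoded by its multiplicities: m (c, j) is the
   number of occurrences of the part j.+1 in color c. Parts and multiplicities of
   a partition of n never exceed n. *)
Definition colored_partitions (k n : nat) : {set {ffun 'I_k * 'I_n -> 'I_n.+1}} :=
  [set m : {ffun 'I_k * 'I_n -> 'I_n.+1}
     | (\sum_(x : 'I_k * 'I_n) m x * x.2.+1 == n)%N].

Definition RD (k l t n : nat) : nat :=
  #|[set m in colored_partitions k n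
      | [forall x : 'I_k * 'I_n,
           ((l %| x.2.+1) ==> (m x == 0 :> nat)) && (m x < t)]]|%N.

(* The sequence is indexed from 1; the value at 0 is irrelevant. *)
Definition y2 (i : nat) : nat := nth 0 [:: 3 ^ 2; 3 ^ 7; 3 ^ 10]%N i.-1.

(* Main.v *)
Require Import Defs.
From mathcomp Require Import all_boot all_order all_algebra.
From mathcomp Require Import ring zify.

(** Write [f_r] for the power series collecting the coefficients of [f] of
    index congruent to [r] modulo 3, so that
    [f(q) = f_0(q^3) + q f_1(q^3) + q^2 f_2(q^3)]. The generating function is
    [(E_3 E_27 / (E_1 E_81))^3] ([RD_gf]), and every factor except [1 / E_1^3] is
    a series in [q^3]; hence everything reduces to the 3-dissection of
    [1 / E_1^3], applied once for the class 2 modulo 3 and once more, to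
    [(1 / E_1^3)^3], for the class 2 modulo 9.

    Jacobi's identity [E_1^3 = sum_i (-1)^i (2 i + 1) q^(i (i + 1) / 2)] gives
    [E_1^3 = P(q^3) - 3 q E_9^3] for some series [P] ([E1cube_dissect]), because
    [i (i + 1) / 2] is never 2 modulo 3, and is 1 exactly for [i = 3 j + 1], where
    it equals [9 j (j + 1) / 2 + 1]. The conjugates of [E_1^3] under [q -> w^k q],
    with [w] a primitive cube root of unity, are [P(q^3) - 3 w^k q E_9^3], so
      [1 / E_1^3 = (P^2 + 3 q P E_9^3 + 9 q^2 E_9^6) / (P^3 - 27 q^3 E_9^9)]
    with [P] taken at [q^3]. The denominator is the cube of the norm
    [E_1(q) E_1(w q) E_1(w^2 q) = E_3^4 / E_9], which is computed factor by
    factor from the infinite product ([norm3_E1]). Roots of unity stay implicit: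
    the norm of [f] is a cubic form with integer coefficients in its sections
    [f_0, f_1, f_2], multiplicative in [f] ([norm3M]).

    Thus [P^3 = E_1^12 / E_3^3 + 27 q E_3^9] ([E1cube0_cube]). The coefficient of
    [q^2] in the numerator above yields the first identity. For the second, with
    [u = E_1^12 / E_3^3] and [v = 27 q E_3^9], the terms of index 0 modulo 3 in the
    cube of the numerator are
      [P^6 + 7 P^3 v + v^2 = u^2 + 9 u v + 9 v^2],
    whose three terms are the three summands of the statement.

    Infinite products and sums are handled by congruences modulo [q^N]. Jacobi's
    identity is the limit of a finite version ([jacobi_finite]), obtained by
    differentiating the q-binomial theorem at the root [z = 1]. *)

Set Implicit Arguments.
Unset Strict Implicit.
Unset Printing Implicit Defensive.

Import GRing.Theory.
Local Open Scope ring_scope.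

(** * Power series modulo powers of q *)

Lemma big_multiples (S : Type) (idx : S) (op : Monoid.law idx) (k N : nat)
    (F : nat -> S) : (0 < k)%N ->
  \big[op/idx]_(1 <= i < N.+1 | (k %| i)%N) F i =
  \big[op/idx]_(1 <= j < (N %/ k).+1) F (k * j)%N.
Proof.
move=> k_gt0; elim: N => [|N IHN]; first by rewrite div0n !big_nil.
rewrite big_mkcond big_nat_recr //= -big_mkcond IHN /= divnS //.
case: ifP => [kN|_]; last by rewrite add0n Monoid.mulm1.
have -> : F N.+1 = F (k * (N %/ k).+1)%N.
  by rewrite -{1}(divnK kN) divnS // kN add1n mulnC.
by rewrite add1n [RHS]big_nat_recr.
Qed.

Section Coefficients.
Variable R : comUnitRingType.
Implicit Types f g h : {fps R}.

Lemma fcoefD f g n : fcoef (f + g) n = fcoef f n + fcoef g n. Proof. by []. Qed.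
Lemma fcoefN f n : fcoef (- f) n = - fcoef f n. Proof. by []. Qed.
Lemma fcoef0 n : fcoef (0 : {fps R}) n = 0. Proof. by []. Qed.
Lemma fcoef1 n : fcoef (1 : {fps R}) n = (n == 0%N)%:R. Proof. by []. Qed.
Lemma fcoefM f g n :
  fcoef (f * g) n = \sum_(i < n.+1) fcoef f i * fcoef g (n - i).
Proof. by []. Qed.

Lemma fcoef_sum (I : Type) (r : seq I) (P : pred I) (F : I -> {fps R}) n :
  fcoef (\sum_(i <- r | P i) F i) n = \sum_(i <- r | P i) fcoef (F i) n.
Proof. by rewrite (big_morph (fun f => fcoef f n) (id1 := 0) (op1 := +%R)). Qed.

Lemma fcoefMq f n : fcoef (f * 'q) n = if n is m.+1 then fcoef f m else 0.
Proof.
rewrite fcoefM; case: n => [|n]; first by rewrite big_ord1 /= mulr0.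
rewrite !big_ord_recr /= subnn mulr0 addr0 subSnn mulr1 big1 ?add0r // => i _.
by rewrite subSn 1?ltnW // eqSS subn_eq0 leqNgt ltn_ord mulr0.
Qed.

Lemma fcoefMqn f k n :
  fcoef (f * 'q ^+ k) n = if (n < k)%N then 0 else fcoef f (n - k).
Proof.
elim: k n => [|k IHk] n; first by rewrite mulr1 subn0.
by rewrite exprSr mulrA fcoefMq; case: n => // n; rewrite IHk.
Qed.

Lemma fcoef_qn k n : fcoef ('q ^+ k : {fps R}) n = (n == k)%:R.
Proof.
rewrite -[_ ^+ k]mul1r fcoefMqn fcoef1 subn_eq0.
by case: ltngtP.
Qed.

(** The series [q] is not a unit, so powers of it are cancelled with this. *)
Lemma mulqnI k : injective (fun f => f * 'q ^+ k).
Proof.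
move=> f g /fpsP efg; apply/fpsP => n.
by have := efg (n + k)%N; rewrite !fcoefMqn ltnNge leq_addl addnK.
Qed.

Definition eqmodq N f g := forall n, (n < N)%N -> fcoef f n = fcoef g n.

Lemma eqmodq_refl N f : eqmodq N f f. Proof. by []. Qed.
Lemma eqmodq_sym N f g : eqmodq N f g -> eqmodq N g f.
Proof. by move=> fg n nN; rewrite fg. Qed.
Lemma eqmodq_trans N g f h : eqmodq N f g -> eqmodq N g h -> eqmodq N f h.
Proof. by move=> fg gh n nN; rewrite fg ?gh. Qed.
Lemma eqmodqW M N f g : (N <= M)%N -> eqmodq M f g -> eqmodq N f g.
Proof. by move=> NM fg n nN; apply: fg; apply: leq_trans NM. Qed.
Lemma eqmodqP f g : (forall N, eqmodq N f g) -> f = g.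
Proof. by move=> fg; apply/fpsP => n; apply: (fg n.+1). Qed.

Lemma eqmodqD N f f' g g' :
  eqmodq N f f' -> eqmodq N g g' -> eqmodq N (f + g) (f' + g').
Proof. by move=> ff gg n nN; rewrite !fcoefD ff ?gg. Qed.
Lemma eqmodqN N f f' : eqmodq N f f' -> eqmodq N (- f) (- f').
Proof. by move=> ff n nN; rewrite !fcoefN ff. Qed.
Lemma eqmodqM N f f' g g' :
  eqmodq N f f' -> eqmodq N g g' -> eqmodq N (f * g) (f' * g').
Proof.
move=> ff gg n nN; rewrite !fcoefM; apply: eq_bigr => i _.
by rewrite ff ?gg //; apply: leq_ltn_trans nN; rewrite ?leq_subr // -ltnS.
Qed.
Lemma eqmodqX N f f' k : eqmodq N f f' -> eqmodq N (f ^+ k) (f' ^+ k).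
Proof. by move=> ff; elim: k => // k IH; rewrite !exprS; apply: eqmodqM. Qed.
Lemma eqmodq_sum N (I : eqType) (r : seq I) (P : pred I) (F G : I -> {fps R}) :
  (forall i, P i -> i \in r -> eqmodq N (F i) (G i)) ->
  eqmodq N (\sum_(i <- r | P i) F i) (\sum_(i <- r | P i) G i).
Proof.
move=> FG; rewrite !(big_seq_cond P).
elim/big_ind2: _ => // [f f' g g'|i /andP[ir Pi]]; [exact: eqmodqD|exact: FG].
Qed.
Lemma eqmodq_prod N (I : eqType) (r : seq I) (P : pred I) (F G : I -> {fps R}) :
  (forall i, P i -> i \in r -> eqmodq N (F i) (G i)) ->
  eqmodq N (\prod_(i <- r | P i) F i) (\prod_(i <- r | P i) G i).
Proof.
move=> FG; rewrite !(big_seq_cond P).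
elim/big_ind2: _ => // [f f' g g'|i /andP[ir Pi]]; [exact: eqmodqM|exact: FG].
Qed.
Lemma eqmodq_prod1 N (I : eqType) (r : seq I) (P : pred I) (F : I -> {fps R}) :
  (forall i, P i -> i \in r -> eqmodq N (F i) 1) ->
  eqmodq N (\prod_(i <- r | P i) F i) 1.
Proof. by move=> /eqmodq_prod F1; apply: eqmodq_trans F1 _; rewrite big1_eq. Qed.
Lemma eqmodq_sum0 N (I : eqType) (r : seq I) (P : pred I) (F : I -> {fps R}) :
  (forall i, P i -> i \in r -> eqmodq N (F i) 0) ->
  eqmodq N (\sum_(i <- r | P i) F i) 0.
Proof. by move=> /eqmodq_sum F0; apply: eqmodq_trans F0 _; rewrite big1_eq. Qed.
Lemma eqmodqMqn N f k : (N <= k)%N -> eqmodq N (f * 'q ^+ k) 0.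
Proof. by move=> Nk n nN; rewrite fcoefMqn (leq_trans nN). Qed.

(** * Sections and inflation *)

Definition sec k r f : {fps R} := Fps (fun n => fcoef f (k * n + r)).
(** The substitution [q -> q^k]. *)
Definition infl k f : {fps R} :=
  Fps (fun n => if (k %| n)%N then fcoef f (n %/ k) else 0).

Lemma fcoef_sec k r f n : fcoef (sec k r f) n = fcoef f (k * n + r).
Proof. by []. Qed.

Variable k : nat.
Hypothesis k_gt0 : (0 < k)%N.

Lemma secP f g : (forall r, (r < k)%N -> sec k r f = sec k r g) -> f = g.
Proof.
move=> fg; apply/fpsP => n.
have /fpsP/(_ (n %/ k)%N) /= := fg (n %% k)%N (ltn_pmod _ k_gt0).
by rewrite mulnC -divn_eq.
Qed.

Lemma secD r f g : sec k r (f + g) = sec k r f + sec k r g.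
Proof. exact/fpsP. Qed.
Lemma secN r f : sec k r (- f) = - sec k r f.
Proof. exact/fpsP. Qed.
Lemma sec_zero r : sec k r 0 = 0.
Proof. exact/fpsP. Qed.
Lemma sec_sum r (I : Type) (s : seq I) (P : pred I) (F : I -> {fps R}) :
  sec k r (\sum_(i <- s | P i) F i) = \sum_(i <- s | P i) sec k r (F i).
Proof. by rewrite (big_morph (sec k r) (id1 := 0) (op1 := +%R)) ?sec_zero//; apply: secD. Qed.

Lemma sec_infl r f : (r < k)%N -> sec k r (infl k f) = if r == 0%N then f else 0.
Proof.
move=> rk; apply/fpsP => n /=; rewrite dvdn_addr ?dvdn_mulr //.
case: r rk => [|r] rk; first by rewrite dvdn0 addn0 mulKn.
by rewrite gtnNdvd.
Qed.

(** The section operators are linear over the series in [q^k]; this is what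
    extracts an arithmetic progression from a product. *)
Lemma sec_inflM r f g : (r < k)%N -> sec k r (infl k f * g) = f * sec k r g.
Proof.
move=> rk; apply/fpsP => n; rewrite fcoefM /=.
pose F i := (if (k %| i)%N then fcoef f (i %/ k) else 0) * fcoef g (k * n + r - i).
pose G i := fcoef f i * fcoef g (k * (n - i) + r).
rewrite -[LHS](big_mkord predT F) -(big_mkord predT G).
rewrite big_ltn // [RHS]big_ltn //; congr (_ + _).
  by rewrite /F /G dvdn0 div0n !subn0.
rewrite (bigID (fun i => (k %| i)%N)) /= addrC big1 ?add0r; last first.
  by move=> i /negPf ki; rewrite /F ki mul0r.
rewrite big_multiples // divnDl ?dvdn_mulr // mulKn // divn_small // addn0.
apply: eq_big_nat => i /andP[_ iN].
by rewrite /F /G dvdn_mulr // mulKn // mulnBr addnBAC // leq_mul2l -ltnS iN orbT.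
Qed.

Lemma inflM f g : infl k (f * g) = infl k f * infl k g.
Proof.
apply: secP => r rk; rewrite sec_inflM // !sec_infl //.
by case: eqP => _; rewrite ?mulr0.
Qed.

Lemma inflD f g : infl k (f + g) = infl k f + infl k g.
Proof. by apply/fpsP => n; rewrite fcoefD /=; case: ifP; rewrite ?addr0. Qed.

Lemma inflN f : infl k (- f) = - infl k f.
Proof. by apply/fpsP => n; rewrite fcoefN /=; case: ifP; rewrite ?oppr0. Qed.

Lemma infl1 : infl k 1 = 1.
Proof.
apply/fpsP => -[|n] /=; first by rewrite dvdn0 div0n.
by case: ifP => // kn; rewrite eqn0Ngt divn_gt0 // dvdn_leq.
Qed.

Lemma inflX f m : infl k (f ^+ m) = infl k f ^+ m.
Proof. by elim: m => [|m IH]; rewrite ?infl1 // !exprS inflM IH. Qed.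

Lemma infl_nat m : infl k m%:R = m%:R.
Proof.
elim: m => [|m IH]; last by rewrite -addn1 !natrD inflD IH infl1.
by apply/fpsP => n /=; case: ifP.
Qed.

Lemma infl_qn m : infl k ('q ^+ m) = 'q ^+ (k * m).
Proof.
apply/fpsP => n /=; rewrite !fcoef_qn; case: ifP => [/dvdnP[i ->]|kn].
  by rewrite mulnK // mulnC eqn_mul2l -(negbK (k == 0)%N) -lt0n k_gt0.
by case: eqP kn => // ->; rewrite dvdn_mulr.
Qed.

Lemma sec_qn r m : (r < k)%N ->
  sec k r ('q ^+ m) = if (m %% k == r)%N then 'q ^+ (m %/ k) else 0.
Proof.
move=> rk; apply/fpsP => n /=; rewrite fcoef_qn.
case: (eqVneq (m %% k)%N r) => [<-|mr]; rewrite ?fcoef_qn ?fcoef0.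
  rewrite [X in (_ == X)%:R = _](divn_eq m k) eqn_add2r mulnC eqn_mul2r.
  by rewrite -(negbK (k == 0)%N) -lt0n k_gt0.
by case: (eqVneq (k * n + r)%N m) mr => // <-; rewrite mulnC modnMDl modn_small // eqxx.
Qed.

Lemma secS_Mq r f : sec k r.+1 (f * 'q) = sec k r f.
Proof. by apply/fpsP => n; rewrite !fcoef_sec addnS fcoefMq. Qed.

Lemma sec0_Mq f : sec k 0 (f * 'q) = sec k k.-1 f * 'q.
Proof.
apply/fpsP => n; rewrite fcoef_sec !fcoefMq addn0; case: n => [|n]; rewrite ?muln0 //.
by rewrite mulnS addnC fcoef_sec; case: k k_gt0 => // k' _; rewrite addnS.
Qed.

Lemma eqmodq_sec N r f g : (r < k)%N ->
  eqmodq (k * N) f g -> eqmodq N (sec k r f) (sec k r g).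
Proof.
move=> rk fg n nN; apply: fg; apply: (@leq_trans (k * n.+1)).
  by rewrite mulnS addnC ltn_add2r.
by rewrite leq_mul2l nN orbT.
Qed.

End Coefficients.

(** * Truncated Euler products *)

Local Notation Q := (fpsX int).

Lemma prod1_recr (A : pzSemiRingType) (F : nat -> A) N :
  \prod_(1 <= m < N.+2) F m = (\prod_(1 <= m < N.+1) F m) * F N.+1.
Proof. by rewrite big_nat_recr. Qed.

Lemma fcoef_E_prod r n N : (0 < r)%N -> (n <= N)%N ->
  fcoef (E r) n = fcoef (\prod_(1 <= m < N.+1) (1 - Q ^+ (m * r))) n.
Proof.
move=> r_gt0 nN; rewrite (fcoef_E r_gt0 nN) => {nN}.
elim: N n => [|N IHN] n; first by rewrite !big_nil coef1.
rewrite !prod1_recr !mulrBr !mulr1 coefB coefMXn fcoefD fcoefN fcoefMqn.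
by rewrite !IHN.
Qed.

(** The omitted factors [1 - q^(m r)], [m > M], are all 1 modulo [q^N]. *)
Lemma E_trunc r N M : (0 < r)%N -> (N <= M.+1 * r)%N ->
  eqmodq N (E r) (\prod_(1 <= m < M.+1) (1 - Q ^+ (m * r))).
Proof.
move=> r_gt0 NM n nN; rewrite (fcoef_E_prod r_gt0 (leq_maxr M n)).
have := leq_maxl M n; move: (maxn M n) => L ML.
rewrite (@big_cat_nat _ _ _ M.+1 1 L.+1) //=.
rewrite -[RHS]/(fcoef _ n) -[in RHS](mulr1 (\prod_(1 <= m < M.+1) _)).
apply: (@eqmodqM _ N) nN => //.
apply: eqmodq_prod1 => m _; rewrite mem_index_iota => /andP[Mm _].
rewrite -[X in eqmodq _ _ X]subr0; apply: eqmodqD => //; apply: eqmodqN.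
rewrite -[Q ^+ _]mul1r; apply: eqmodqMqn.
by apply: leq_trans NM _; rewrite leq_mul2r Mm orbT.
Qed.

Lemma eqmodq_infl (R : comUnitRingType) k N (f g : {fps R}) :
  eqmodq N f g -> eqmodq N (infl k f) (infl k g).
Proof.
move=> fg n nN /=; case: ifP => // _; apply: fg.
by apply: leq_ltn_trans nN; apply: leq_div.
Qed.

Lemma infl_E k r : (0 < k)%N -> (0 < r)%N -> infl k (E r) = E (k * r).
Proof.
move=> k_gt0 r_gt0; apply: eqmodqP => N.
apply: (@eqmodq_trans _ _ (infl k (\prod_(1 <= m < N.+1) (1 - Q ^+ (m * r))))).
  by apply: eqmodq_infl; apply: E_trunc => //; nia.
rewrite (big_morph _ (inflM k_gt0) (infl1 _ k_gt0)).
under eq_bigr do rewrite inflD inflN infl1 // infl_qn // mulnCA.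
by apply: eqmodq_sym; apply: E_trunc; nia.
Qed.

(** Only the indices [m = l a] occur, and [a <= N %/ l] suffices since the first
    omitted exponent [((N %/ l) + 1) l r] exceeds [N]. *)
Lemma E_multiples l r N : (0 < l)%N -> (0 < r)%N ->
  eqmodq N.+1 (E (l * r)) (\prod_(1 <= m < N.+1 | (l %| m)%N) (1 - Q ^+ (m * r))).
Proof.
move=> l_gt0 r_gt0; rewrite big_multiples //.
under eq_bigr do rewrite (mulnC l) -mulnA.
apply: E_trunc; first by rewrite muln_gt0 l_gt0.
by rewrite mulnA; apply: leq_trans (ltn_ceil N l_gt0) _; rewrite leq_pmulr.
Qed.

Lemma E_coprime l r N : (0 < l)%N -> (0 < r)%N -> eqmodq N.+1
  (\prod_(1 <= m < N.+1 | ~~ (l %| m)%N) (1 - Q ^+ (m * r)) * E (l * r)) (E r).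
Proof.
move=> l_gt0 r_gt0.
apply: eqmodq_trans (eqmodqM (@eqmodq_refl _ _ _) (@E_multiples _ _ _ l_gt0 r_gt0)) _.
apply: eqmodq_sym; rewrite mulrC.
have <- : \prod_(1 <= m < N.+1) (1 - Q ^+ (m * r)) =
    \prod_(1 <= m < N.+1 | (l %| m)%N) (1 - Q ^+ (m * r)) *
    \prod_(1 <= m < N.+1 | ~~ (l %| m)%N) (1 - Q ^+ (m * r)).
  by rewrite (bigID (fun m => l %| m)%N).
by apply: E_trunc => //; rewrite leq_pmulr.
Qed.

(** * Finite and infinite forms of Jacobi's identity *)

Definition qfac n := \prod_(1 <= m < n.+1) (1 - Q ^+ m).

Lemma qfac0 : qfac 0 = 1. Proof. by rewrite /qfac big_nil. Qed.
Lemma qfacS n : qfac n.+1 = qfac n * (1 - Q ^+ n.+1).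
Proof. by rewrite /qfac big_nat_recr. Qed.
Lemma qfac_unit n : qfac n \is a GRing.unit.
Proof.
elim: n => [|n IHn]; first by rewrite qfac0 unitr1.
rewrite qfacS unitrM IHn fps_unitE fcoefD fcoefN fcoef_qn fcoef1 /=.
by rewrite subr0 unitr1.
Qed.
Lemma E1_qfac N n : (N <= n.+1)%N -> eqmodq N (E 1) (qfac n).
Proof.
move=> Nn; rewrite /qfac; under eq_bigr do rewrite -[X in Q ^+ X]muln1.
by apply: E_trunc => //; rewrite muln1.
Qed.

(** The value 0 beyond [N] makes the Pascal rule [qbinS] hold also at [j = N]. *)
Definition qbin N j : {fps int} :=
  if (j <= N)%N then qfac N / (qfac j * qfac (N - j)) else 0.

Lemma qbin_n0 N : qbin N 0 = 1.
Proof. by rewrite /qbin qfac0 subn0 mul1r divrr ?qfac_unit. Qed.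

Lemma qbin_fac N j : (j <= N)%N -> qbin N j * (qfac j * qfac (N - j)) = qfac N.
Proof. by move=> jN; rewrite /qbin jN divrK // unitrM !qfac_unit. Qed.

(** Multiplying by the denominator turns this Pascal rule into
    [1 - q^(N+1) = (1 - q^(N-j)) + q^(N-j) (1 - q^(j+1))]. *)
Lemma qbinS N j : (j <= N)%N ->
  qbin N.+1 j.+1 = qbin N j.+1 + Q ^+ (N - j) * qbin N j.
Proof.
move=> jN; have u : qfac j.+1 * qfac (N - j) \is a GRing.unit.
  by rewrite unitrM !qfac_unit.
apply: (mulIr u); rewrite -{1}subSS qbin_fac // mulrDl.
have e2 : Q ^+ (N - j) * qbin N j * (qfac j.+1 * qfac (N - j)) =
    Q ^+ (N - j) * (1 - Q ^+ j.+1) * qfac N.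
  by rewrite -[in RHS](qbin_fac jN) qfacS; ring.
have e1 : qbin N j.+1 * (qfac j.+1 * qfac (N - j)) = (1 - Q ^+ (N - j)) * qfac N.
  case: (ltngtP j N) jN => // [jN|->] _; last first.
    by rewrite {1}/qbin ltnn subnn subrr !mul0r.
  have -> : (N - j = (N - j.+1).+1)%N by lia.
  by rewrite -[in RHS](qbin_fac jN) [qfac (N - _).+1]qfacS; ring.
rewrite e1 e2 qfacS; have {1}-> : (N.+1 = (N - j) + j.+1)%N by lia.
by rewrite exprD; ring.
Qed.

(** Keeping [a] as a second variable makes it possible to put the root at
    [z = 1] with [a = q^n], where the usual form would need [z = q^(-n)]. *)
Lemma qbinomial N (a : {fps int}) :
  \prod_(0 <= k < N) (a%:P - (Q ^+ k)%:P * 'X) =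
  \poly_(j < N.+1) ((-1) ^+ j * Q ^+ 'C(j, 2) * qbin N j * a ^+ (N - j)).
Proof.
elim: N => [|N IHN].
  rewrite big_nil; apply/polyP => -[|j]; rewrite coef1 coef_poly //=.
  by rewrite qbin_n0 !mul1r.
rewrite big_nat_recr //= {}IHN; apply/polyP => j.
rewrite mulrBr coefB coefMC mulrCA coefCM coefMX !coef_poly.
case: j => [|j] /=; first by rewrite !qbin_n0 !subn0 exprS; ring.
rewrite !ltnS subSS; case: (ltngtP j N) => [jN|Nj|->]; last 2 first.
- by rewrite mul0r mulr0 subr0.
- rewrite mul0r sub0r subnn !expr0 !mulr1 (qbinS (leqnn N)) subnn mul1r.
  rewrite {2}/qbin ltnn add0r binS bin1 exprD exprS; ring.
rewrite (qbinS (ltnW jN)) binS bin1.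
have -> : (N - j = (N - j.+1).+1)%N by lia.
have -> : Q ^+ N = Q ^+ (N - j.+1).+1 * Q ^+ j by rewrite -exprD; congr (_ ^+ _); lia.
rewrite exprD !exprS; ring.
Qed.

Lemma bin2_double i : (2 * 'C(i, 2) + i = i * i)%N.
Proof. elim: i => // i IH; rewrite binS bin1; lia. Qed.

(** The exponents of [q] in the terms [j = n - i] and [j = n + 1 + i] of the
    expansion at [a = q^n], written with [m = n - i]: both exceed the exponent
    [i (i + 1) / 2] of Jacobi's series by the same amount. *)
Lemma exponent_low m i :
  ('C(m, 2) + (m + i) * (m + i + i.+1) =
   'C(i.+1, 2) + ('C(m + i, 2) + (m + i) * (m + i) + (m + i)))%N.
Proof.
move: (bin2_double m) (bin2_double i.+1) (bin2_double (m + i)); lia.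
Qed.

Lemma exponent_high m i :
  ('C(i + (m + i).+1, 2) + (m + i) * m =
   'C(i.+1, 2) + ('C(m + i, 2) + (m + i) * (m + i) + (m + i)))%N.
Proof.
move: (bin2_double (i + (m + i).+1)) (bin2_double i.+1) (bin2_double (m + i)).
lia.
Qed.

Lemma deriv_horner1 (A : comNzRingType) m (c : nat -> A) :
  (\poly_(j < m) c j)^`().[1] = \sum_(0 <= j < m) c j * j%:R.
Proof.
rewrite poly_def raddf_sum /= horner_sum big_mkord; apply: eq_bigr => j _.
by rewrite derivZ derivXn hornerZ hornerMn hornerXn expr1n.
Qed.

Lemma qbin_sub N j : (j <= N)%N -> qbin N (N - j) = qbin N j.
Proof. by move=> jN; rewrite /qbin jN leq_subr subKn // [qfac j * _]mulrC. Qed.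

Lemma prod_below n :
  \prod_(0 <= k < n) (Q ^+ n - Q ^+ k) = (-1) ^+ n * Q ^+ 'C(n, 2) * qfac n.
Proof.
have -> : 'C(n, 2) = (\sum_(0 <= k < n) k)%N by rewrite bin2_sum.
have -> : qfac n = \prod_(0 <= k < n) (1 - Q ^+ (n - k)).
  rewrite /qfac big_add1 /= big_nat_rev; apply: eq_big_nat => k /andP[_ kn].
  by congr (1 - Q ^+ _); lia.
rewrite -[X in (-1) ^+ X]subn0 -prodr_const_nat -prodrXr -!big_split /=.
apply: eq_big_nat => k /andP[_ kn].
by rewrite -[X in Q ^+ X - _](subnK (ltnW kn)) exprD; ring.
Qed.

(** The product of the [q^n - q^k z] over [k <= 2 n] vanishes at [z = 1] through
    its factor [k = n] only, so its derivative there is, up to sign and a power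
    of [q], the product of the other factors, that is the square of the
    q-factorial. On the expanded side the terms [j = n - i] and [j = n + 1 + i]
    have equal q-binomials and powers of [q] and opposite signs, and their
    weights [j] combine to [2 i + 1]. *)
Lemma jacobi_finite n :
  qfac n ^+ 2 = \sum_(0 <= i < n.+1)
    (-1) ^+ i * (2 * i + 1)%:R * Q ^+ 'C(i.+1, 2) * qbin (2 * n + 1) (n - i).
Proof.
have := congr1 (fun p => p^`().[1]) (qbinomial (n + n.+1) (Q ^+ n)).
rewrite deriv_horner1 -addSn.
rewrite (@big_cat_nat _ _ _ n 0 (n + n.+1)) ?leq_addr //=.
rewrite (@big_ltn _ _ _ n (n + n.+1)); last by rewrite addnS ltnS leq_addr.
set L := \prod_(0 <= k < n) _; set H := \prod_(n.+1 <= k < _) _.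
have -> : (L * (((Q ^+ n)%:P - (Q ^+ n)%:P * 'X) * H))^`().[1] =
    - Q ^+ n * (L.[1] * H.[1]).
  rewrite !derivM derivB derivC derivM derivX derivC !hornerE /=; ring.
have -> : L.[1] = (-1) ^+ n * Q ^+ 'C(n, 2) * qfac n.
  rewrite -prod_below /L horner_prod; apply: eq_bigr => k _; rewrite !hornerE //.
have -> : H.[1] = Q ^+ (n * n) * qfac n.
  rewrite /H horner_prod -{1}add1n big_addn addKn /qfac.
  have -> : Q ^+ (n * n) = \prod_(1 <= m < n.+1) Q ^+ n.
    by rewrite prodr_const_nat subn1 exprM.
  rewrite -big_split; apply: eq_bigr => k _; rewrite !hornerE exprD /=; ring.
(* The first half of the sum is reversed so that index i meets n - i and n + 1 + i. *)
rewrite (@big_cat_nat _ _ _ n.+1 0) ?leq_addr //=.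
rewrite (@big_addn _ _ _ 0 (n.+1 + n.+1) n.+1) addnK big_nat_rev -big_split /=.
rewrite (eq_big_nat _ _ (F2 := fun i => (- (-1) ^+ n) *
   (((-1) ^+ i * (2 * i + 1)%:R * Q ^+ 'C(i.+1, 2) * qbin (2 * n + 1) (n - i)) *
     Q ^+ ('C(n, 2) + n * n + n)))); last first.
  move=> i; rewrite add0n ltnS => /= iN.
  set m := (n - i)%N; have nE : n = (m + i)%N by rewrite subnK.
  have -> : (n.+1 - i.+1 = m)%N by [].
  have -> : (2 * n + 1 = n + n.+1)%N by lia.
  have -> : qbin (n + n.+1) (i + n.+1) = qbin (n + n.+1) m.
    rewrite -qbin_sub; last by lia.
    by congr qbin; lia.
  have -> : (n + n.+1 - (i + n.+1) = m)%N by lia.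
  have -> : (n + n.+1 - m = n + i.+1)%N by lia.
  set B := qbin _ _.
  have e1 : Q ^+ 'C(m, 2) * Q ^+ n ^+ (n + i.+1) =
      Q ^+ 'C(i.+1, 2) * Q ^+ ('C(n, 2) + n * n + n).
    rewrite -exprM -!exprD; congr (_ ^+ _).
    by rewrite nE exponent_low.
  have e2 : Q ^+ 'C(i + n.+1, 2) * Q ^+ n ^+ m =
      Q ^+ 'C(i.+1, 2) * Q ^+ ('C(n, 2) + n * n + n).
    rewrite -exprM -!exprD; congr (_ ^+ _).
    by rewrite nE exponent_high.
  transitivity ((Q ^+ 'C(m, 2) * Q ^+ n ^+ (n + i.+1)) * ((-1) ^+ m * B * m%:R) +
     (Q ^+ 'C(i + n.+1, 2) * Q ^+ n ^+ m) * ((-1) ^+ (i + n.+1) * B * (i + n.+1)%:R)).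
    by ring.
  rewrite e1 e2.
  have -> : (-1) ^+ m = (-1) ^+ n * (-1) ^+ i :> {fps int}.
    by rewrite nE exprD -mulrA -exprD addnn -mul2n exprM sqrrN !expr1n mulr1.
  have -> : (i + n.+1 = m + (2 * i + 1))%N by rewrite nE; lia.
  have -> : (-1) ^+ (m + (2 * i + 1)) = - (-1) ^+ n * (-1) ^+ i :> {fps int}.
    have -> : (m + (2 * i + 1) = (n + i).+1)%N by lia.
    by rewrite exprS mulN1r exprD mulNr.
  by rewrite [(m + _)%:R]natrD; ring.
rewrite -mulr_sumr -mulr_suml => e.
apply: (@mulqnI _ ('C(n, 2) + n * n + n)).
have u : (- (-1) ^+ n : {fps int}) \is a GRing.unit by rewrite unitrN unitrX // unitrN1.
apply: (mulrI u); rewrite -{}e !exprD; ring.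
Qed.

(** Far from both ends a q-binomial coefficient is close to [1 / E_1]. *)
Lemma qbin_E1 N n j : (j <= n)%N -> (N <= j.+1)%N -> (N <= (n - j).+1)%N ->
  eqmodq N (qbin n j * E 1) 1.
Proof.
move=> jn Nj Nnj; rewrite -[qbin n j * _](mulrK (unit_E 1)).
rewrite -[X in eqmodq _ _ X](mulrV (unit_E 1)).
apply: eqmodqM => //; rewrite -mulrA.
apply: eqmodq_trans (_ : eqmodq N (qbin n j * (qfac j * qfac (n - j))) _).
  by apply: eqmodqM => //; apply: eqmodqM; apply: E1_qfac.
rewrite qbin_fac //; apply: eqmodq_sym; apply: E1_qfac.
by apply: leq_trans Nj _; rewrite ltnS.
Qed.

(** Jacobi's identity; truncating the sum at [i < N] loses nothing modulo [q^N]
    because [i (i + 1) / 2 >= i]. *)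
Lemma jacobi N : eqmodq N (E 1 ^+ 3)
  (\sum_(0 <= i < N) (-1) ^+ i * (2 * i + 1)%:R * Q ^+ 'C(i.+1, 2)).
Proof.
(* With n = 2 N, both n - i and n + 1 + i are at least N as long as i < N. *)
pose n := (2 * N)%N; rewrite exprSr.
apply: (@eqmodq_trans _ _ (qfac n ^+ 2 * E 1)).
  by apply: eqmodqM => //; apply: eqmodqX; apply: E1_qfac; lia.
rewrite jacobi_finite (@big_cat_nat _ _ _ N) //=; last by lia.
rewrite mulrDl -[X in eqmodq _ _ X]addr0; apply: eqmodqD.
  rewrite mulr_suml; apply: eqmodq_sum => i _; rewrite mem_index_iota => iN.
  rewrite -mulrA -[X in eqmodq _ _ X]mulr1; apply: eqmodqM => //.
  by apply: qbin_E1; lia.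
rewrite mulr_suml; apply: eqmodq_sum0 => i _; rewrite mem_index_iota => /andP[Ni _].
rewrite -mulrA mulrAC; apply: eqmodqMqn; rewrite binS bin1; lia.
Qed.

(** * The 3-dissection of the cube of E 1 *)

Lemma sum_recr (A : nmodType) (F : nat -> A) N :
  \sum_(0 <= i < N.+1) F i = \sum_(0 <= i < N) F i + F N.
Proof. by rewrite big_nat_recr. Qed.

Lemma sum_triples (A : nmodType) (F : nat -> A) N :
  \sum_(0 <= i < 3 * N) F i =
  \sum_(0 <= j < N) (F (3 * j)%N + F (3 * j + 1)%N + F (3 * j + 2)%N).
Proof.
elim: N => [|N IHN]; first by rewrite !big_nil.
rewrite mulnS addnC !addnS !addn0 !sum_recr IHN.
by rewrite addn1 addn2 !addrA.
Qed.

(** Triangular numbers modulo 3, which decide the section of each term of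
    Jacobi's series; the middle case carries the quotient [3 'C(j.+1, 2)] that
    reproduces the same series in [q^3]. *)
Lemma binom_tri0 j : 'C((3 * j).+1, 2) = (3 * (3 * 'C(j, 2) + 2 * j))%N.
Proof. by move: (bin2_double (3 * j).+1) (bin2_double j); lia. Qed.
Lemma binom_tri1 j : 'C((3 * j + 1).+1, 2) = ((3 * 'C(j.+1, 2)) * 3 + 1)%N.
Proof. by move: (bin2_double (3 * j + 1).+1) (bin2_double j.+1); lia. Qed.
Lemma binom_tri2 j : 'C((3 * j + 2).+1, 2) = (3 * (3 * 'C(j, 2) + 4 * j + 1))%N.
Proof. by move: (bin2_double (3 * j + 2).+1) (bin2_double j); lia. Qed.

Lemma sec_cst (R : comUnitRingType) k r (k0 : (0 < k)%N) i m (f : {fps R}) : (r < k)%N ->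
  sec k r ((-1) ^+ i * m%:R * f) = (-1) ^+ i * m%:R * sec k r f.
Proof.
move=> rk; have {1}-> : (-1) ^+ i * m%:R = infl k ((-1) ^+ i * m%:R) :> {fps R}.
  by rewrite inflM // inflX // inflN infl1 // infl_nat.
by rewrite sec_inflM.
Qed.

Lemma sec_E1cube r N : (r < 3)%N -> eqmodq N (sec 3 r (E 1 ^+ 3))
  (\sum_(0 <= i < 3 * N) (-1) ^+ i * (2 * i + 1)%:R *
      (if ('C(i.+1, 2) %% 3 == r)%N then Q ^+ ('C(i.+1, 2) %/ 3) else 0)).
Proof.
move=> r3; apply: eqmodq_trans (eqmodq_sec r3 (@jacobi _)) _.
rewrite sec_sum; apply: eqmodq_sum => i _ _.
by rewrite sec_cst // sec_qn.
Qed.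

Lemma sec2_E1cube : sec 3 2 (E 1 ^+ 3) = 0.
Proof.
apply: eqmodqP => N; apply: eqmodq_trans (@sec_E1cube 2 N _) _ => //.
rewrite sum_triples big1 // => j _.
by rewrite binom_tri0 binom_tri1 binom_tri2 !modnMr modnMDl /= !mulr0 !addr0.
Qed.

(** For [i = 3 j + 1] the coefficient is [- 3 (-1)^j (2 j + 1)], so the section is
    [- 3] times Jacobi's series in [q^3]. *)
Lemma sec1_E1cube : sec 3 1 (E 1 ^+ 3) = - 3 * E 3 ^+ 3.
Proof.
apply: eqmodqP => N; apply: eqmodq_trans (@sec_E1cube 1 N _) _ => //.
have -> : E 3 = infl 3 (E 1) by rewrite infl_E.
rewrite -inflX //.
apply: eqmodq_sym.
apply: eqmodq_trans (eqmodqM (@eqmodq_refl _ _ _) (eqmodq_infl 3 (@jacobi N))) _.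
rewrite (big_morph (infl 3) (id1 := 0) (op1 := +%R)); last 2 first.
- exact: inflD.
- exact: (@infl_nat _ 3 isT 0).
rewrite mulr_sumr sum_triples; apply: eqmodq_sum => j _ _.
rewrite binom_tri0 binom_tri1 binom_tri2 !modnMr modnMDl /= !mulr0 addr0 add0r.
rewrite divnMDl // addn0 !inflM // inflX // inflN infl1 // infl_nat // infl_qn //.
have -> : (-1) ^+ (3 * j + 1) = - (-1) ^+ j :> {fps int}.
  by rewrite exprD exprM expr1 mulrN1 -[(-1) ^+ 3]signr_odd.
have -> : (2 * (3 * j + 1) + 1 = 3 * (2 * j + 1))%N by lia.
by move=> n _; rewrite [(3 * _)%:R]natrM; congr (fcoef _ n); ring.
Qed.

(** * The cubic norm *)

Section Norm.
Variable R : comUnitRingType.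
Implicit Types f g : {fps R}.

Lemma dissect3 f :
  f = infl 3 (sec 3 0 f) + infl 3 (sec 3 1 f) * 'q + infl 3 (sec 3 2 f) * 'q * 'q.
Proof.
apply: (@secP _ 3) => // -[|[|[|]]] // _;
  by rewrite !secD ?sec0_Mq ?secS_Mq ?sec0_Mq //= ?secS_Mq !sec_infl //
    !(mul0r, addr0, add0r).
Qed.

Lemma sec_dissected (a b c : {fps R}) :
  let f := infl 3 a + infl 3 b * 'q + infl 3 c * 'q * 'q in
  [/\ sec 3 0 f = a, sec 3 1 f = b & sec 3 2 f = c].
Proof.
by split; rewrite !secD ?sec0_Mq ?secS_Mq ?sec0_Mq ?secS_Mq ?sec_infl //=
  ?(mul0r, addr0, add0r).
Qed.

(** The product of [f], dissected, with [g]: linearity over the series in [q^3]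
    leaves sections of [g] shifted by powers of [q]. *)
Lemma secM3 r f g : (r < 3)%N -> sec 3 r (f * g) =
  sec 3 0 f * sec 3 r g + sec 3 1 f * sec 3 r (g * 'q)
  + sec 3 2 f * sec 3 r (g * 'q * 'q).
Proof.
move=> r3; rewrite -!sec_inflM // -!secD; congr sec.
by rewrite {1}[f]dissect3; ring.
Qed.

Lemma secM3_0 f g : sec 3 0 (f * g) =
  sec 3 0 f * sec 3 0 g + sec 3 1 f * (sec 3 2 g * 'q) + sec 3 2 f * (sec 3 1 g * 'q).
Proof. by rewrite secM3 ?sec0_Mq ?secS_Mq. Qed.

Lemma secM3_1 f g : sec 3 1 (f * g) =
  sec 3 0 f * sec 3 1 g + sec 3 1 f * sec 3 0 g + sec 3 2 f * (sec 3 2 g * 'q).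
Proof. by rewrite secM3 ?secS_Mq ?sec0_Mq. Qed.

Lemma secM3_2 f g : sec 3 2 (f * g) =
  sec 3 0 f * sec 3 2 g + sec 3 1 f * sec 3 1 g + sec 3 2 f * sec 3 0 g.
Proof. by rewrite secM3 ?secS_Mq. Qed.

(** The product [f(q) f(w q) f(w^2 q)] for [w] a primitive cube root of unity,
    which is a series in [q^3], read in the variable [q]. *)
Definition norm3 f : {fps R} :=
  sec 3 0 f ^+ 3 + 'q * sec 3 1 f ^+ 3 + 'q ^+ 2 * sec 3 2 f ^+ 3
  - 3 * 'q * sec 3 0 f * sec 3 1 f * sec 3 2 f.

(** The cubic form is the determinant of multiplication by [a0 + a1 x + a2 x^2] on
    the polynomials in [x] modulo [x^3 = q], and the [c_i] are the coordinates of
    the product of two such elements. *)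
Lemma cubic_normM (A : comPzRingType) (q a0 a1 a2 b0 b1 b2 : A) :
  let c0 := a0 * b0 + a1 * (b2 * q) + a2 * (b1 * q) in
  let c1 := a0 * b1 + a1 * b0 + a2 * (b2 * q) in
  let c2 := a0 * b2 + a1 * b1 + a2 * b0 in
  c0 ^+ 3 + q * c1 ^+ 3 + q ^+ 2 * c2 ^+ 3 - 3 * q * c0 * c1 * c2 =
  (a0 ^+ 3 + q * a1 ^+ 3 + q ^+ 2 * a2 ^+ 3 - 3 * q * a0 * a1 * a2) *
  (b0 ^+ 3 + q * b1 ^+ 3 + q ^+ 2 * b2 ^+ 3 - 3 * q * b0 * b1 * b2).
Proof. move=> c0 c1 c2; rewrite /c0 /c1 /c2; ring. Qed.

Lemma norm3M f g : norm3 (f * g) = norm3 f * norm3 g.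
Proof.
by rewrite /norm3 secM3_0 secM3_1 secM3_2; exact: cubic_normM.
Qed.

Lemma norm3_infl f : norm3 (infl 3 f) = f ^+ 3.
Proof. by rewrite /norm3 !sec_infl //=; ring. Qed.

Lemma norm3_1 : norm3 1 = 1.
Proof. by rewrite -(infl1 _ (isT : 0 < 3)%N) norm3_infl expr1n infl1. Qed.

Lemma norm3X f m : norm3 (f ^+ m) = norm3 f ^+ m.
Proof. by elim: m => [|m IH]; rewrite ?norm3_1 // !exprS norm3M IH. Qed.

(** For [m] prime to 3 the three conjugates [1 - w^(k m) q^m] multiply to
    [1 - q^(3 m)], otherwise they coincide; then [q^3] is replaced by [q]. *)
Lemma norm3_1Bqn m : norm3 (1 - 'q ^+ m) =
  if (3 %| m)%N then (1 - 'q ^+ (m %/ 3)) ^+ 3 else 1 - 'q ^+ m.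
Proof.
case: ifP => [/dvdnP[j ->]|].
  rewrite mulnK // -norm3_infl inflD inflN infl1 // infl_qn //.
  by rewrite mulnC.
have s1 r : (r < 3)%N -> sec 3 r (1 - 'q ^+ m : {fps R}) =
    (if r == 0%N then 1 else 0) - if (m %% 3 == r)%N then 'q ^+ (m %/ 3) else 0.
  move=> r3; rewrite secD secN sec_qn // -{1}(infl1 R (isT : 0 < 3)%N) sec_infl //.
rewrite /norm3 !s1 // /dvdn => m3.
rewrite [in RHS](divn_eq m 3) exprD exprM.
by move: (ltn_pmod m (isT : 0 < 3)%N) m3; case: (m %% 3)%N => [|[|[|]]] //= _ _; ring.
Qed.

Lemma eqmodq_norm3 N f g : eqmodq (3 * N) f g -> eqmodq N (norm3 f) (norm3 g).
Proof.
move=> fg; have fgr r : (r < 3)%N -> eqmodq N (sec 3 r f) (sec 3 r g).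
  by move=> r3; apply: eqmodq_sec.
have [f0 f1 f2] := And3 (fgr 0%N isT) (fgr 1%N isT) (fgr 2 isT).
apply: eqmodqD; last by apply: eqmodqN; do 3![apply: eqmodqM => //].
apply: eqmodqD; last by apply: eqmodqM => //; apply: eqmodqX.
by apply: eqmodqD; [|apply: eqmodqM => //]; apply: eqmodqX.
Qed.
End Norm.

(** By [norm3_1Bqn] the norm of the Euler product keeps the factors [1 - q^m] with
    [m] prime to 3 and gains the cube of all factors; the remaining factors, with
    [m] divisible by 3, are those of [E 3]. *)
Lemma norm3_E1 : norm3 (E 1) * E 3 = E 1 ^+ 4.
Proof.
apply: eqmodqP => N.
have e1 : eqmodq (3 * N).+1 (E 1) (\prod_(1 <= m < (3 * N).+1) (1 - Q ^+ m)).
  by apply: E1_qfac.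
have e3 := eqmodqW (_ : N <= (3 * N).+1)%N (@E_multiples 3 1 (3 * N) isT isT).
apply: eqmodq_trans (eqmodqM (eqmodq_norm3 (eqmodqW (leqnSn _) e1)) (e3 _)) _.
  by lia.
rewrite (big_morph _ (@norm3M _) (@norm3_1 _)).
under eq_bigr do rewrite norm3_1Bqn.
under [X in _ * X]eq_bigr do rewrite muln1.
set P := fun m => (3 %| m)%N.
have eB : \prod_(1 <= m < (3 * N).+1) 
      (if P m then (1 - Q ^+ (m %/ 3)) ^+ 3 else 1 - Q ^+ m) =
    (\prod_(1 <= m < N.+1) (1 - Q ^+ m)) ^+ 3 *
    \prod_(1 <= m < (3 * N).+1 | ~~ P m) (1 - Q ^+ m).
  rewrite (bigID P) /=; congr (_ * _); last by apply: eq_bigr => m /negPf->.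
  under eq_bigr => m -> do [].
  rewrite big_multiples // mulKn // -prodrXl; apply: eq_bigr => m _.
  by rewrite mulKn.
have eS : \prod_(1 <= m < (3 * N).+1) (1 - Q ^+ m) =
    \prod_(1 <= m < (3 * N).+1 | P m) (1 - Q ^+ m) *
    \prod_(1 <= m < (3 * N).+1 | ~~ P m) (1 - Q ^+ m) by rewrite (bigID P).
rewrite eB -mulrA [X in _ * X]mulrC -eS [E 1 ^+ 4]exprSr.
by apply: eqmodq_sym; apply: eqmodqM;
  [apply: eqmodqX; apply: E1_qfac|apply: E1_qfac]; lia.
Qed.

(** * The inverse of the cube of E 1 *)

Definition E1cube0 := sec 3 0 (E 1 ^+ 3).

Lemma E1cube_dissect :
  E 1 ^+ 3 = infl 3 E1cube0 - 3 * E 9 ^+ 3 * Q.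
Proof.
rewrite {1}[E 1 ^+ 3]dissect3 sec2_E1cube sec1_E1cube -/E1cube0.
rewrite inflM // inflN infl_nat // inflX // infl_E // (@infl_nat _ 3 isT 0).
by ring.
Qed.

(** The left factor is the norm of [E_1^3], whose sections are known; by
    multiplicativity it is also the cube of the norm of [E_1]. *)
Lemma E1cube0_cube : (E1cube0 ^+ 3 - 27 * Q * E 3 ^+ 9) * E 3 ^+ 3 = E 1 ^+ 12.
Proof.
have -> : E1cube0 ^+ 3 - 27 * Q * E 3 ^+ 9 = norm3 (E 1 ^+ 3).
  by rewrite /norm3 sec2_E1cube sec1_E1cube -/E1cube0; ring.
by rewrite norm3X -exprMn norm3_E1 -exprM.
Qed.

Lemma infl3M (f g : {fps int}) : infl 3 (f * g) = infl 3 f * infl 3 g.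
Proof. exact: inflM. Qed.
Lemma infl3_nat m : infl 3 (m%:R : {fps int}) = m%:R.
Proof. exact: infl_nat. Qed.
Lemma infl_E1X m : infl 3 (E 1 ^+ m) = E 3 ^+ m.
Proof. by rewrite inflX // infl_E. Qed.
Lemma infl_E3X m : infl 3 (E 3 ^+ m) = E 9 ^+ m.
Proof. by rewrite inflX // infl_E. Qed.
Lemma infl_E9X m : infl 3 (E 9 ^+ m) = E 27 ^+ m.
Proof. by rewrite inflX // infl_E. Qed.
Lemma infl_E27X m : infl 3 (E 27 ^+ m) = E 81 ^+ m.
Proof. by rewrite inflX // infl_E. Qed.

(** The product of the two nontrivial conjugates of [E_1^3], that is
    [a^2 + a b + b^2] when [E_1^3 = a - b] with [a] the section of index 0. *)
Definition E1cube_conj : {fps int} :=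
  infl 3 (E1cube0 ^+ 2) + infl 3 (3 * E1cube0 * E 3 ^+ 3) * Q
  + infl 3 (9 * E 3 ^+ 6) * Q * Q.

Lemma E1cube_conjE : E 1 ^+ 3 * E1cube_conj * E 9 ^+ 3 = E 3 ^+ 12.
Proof.
have Wc : infl 3 E1cube0 ^+ 3 - 27 * Q ^+ 3 * E 9 ^+ 9 =
    infl 3 (E1cube0 ^+ 3 - 27 * Q * E 3 ^+ 9).
  rewrite inflD inflN; congr (_ - _); first by rewrite inflX.
  by rewrite infl3M infl_E3X infl3M infl3_nat (@infl_qn _ 3 isT 1).
rewrite -(infl_E1X 12) -E1cube0_cube infl3M infl_E3X -Wc E1cube_dissect /E1cube_conj.
have -> : infl 3 (E1cube0 ^+ 2) = infl 3 E1cube0 ^+ 2 by rewrite inflX.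
have -> : infl 3 (3 * E1cube0 * E 3 ^+ 3) = 3 * infl 3 E1cube0 * E 9 ^+ 3.
  by rewrite infl3M infl_E3X infl3M infl3_nat.
have -> : infl 3 (9 * E 3 ^+ 6) = 9 * E 9 ^+ 6 by rewrite infl3M infl_E3X infl3_nat.
ring.
Qed.

(** In [(1 + x + x^2)^3] the powers 0, 3 and 6 of [x] have coefficients 1, 7 and 1;
    here [x^3] stands for [27 q E_3^9 / P^3]. *)
Lemma sec0_conj_cube : sec 3 0 (E1cube_conj ^+ 3) =
  E1cube0 ^+ 6 + 189 * E1cube0 ^+ 3 * Q * E 3 ^+ 9 + 729 * Q ^+ 2 * E 3 ^+ 18.
Proof.
have [s0 s1 s2] := sec_dissected (E1cube0 ^+ 2) (3 * E1cube0 * E 3 ^+ 3) (9 * E 3 ^+ 6).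
rewrite exprS expr2 !secM3_0 secM3_1 secM3_2 /E1cube_conj s0 s1 s2; ring.
Qed.

(** * The generating function of RD *)

(** Choosing a multiplicity for each colored part is expanding a product of sums;
    parts and multiplicities up to [n] are enough for the coefficient of [q^n]. *)
Lemma RD_coef k l t n : (RD k l t n)%:R =
  fcoef (\prod_(x : 'I_k * 'I_n) \sum_(i < n.+1 |
     ((l %| x.2.+1)%N ==> (i == 0 :> nat)) && (i < t)%N) Q ^+ (i * x.2.+1)) n.
Proof.
rewrite bigA_distr_big_dep fcoef_sum /RD -sum1_card natr_sum.
rewrite big_mkcond [RHS]big_mkcond; apply: eq_bigr => m _.
rewrite !inE prodrXr fcoef_qn [n == _]eq_sym.
by case: (_ == n); case: [forall x, _].
Qed.

Lemma sum_geom_trunc t n m : (0 < m)%N ->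
  eqmodq n.+1 (\sum_(i < n.+1 | (i < t)%N) Q ^+ (i * m)) (\sum_(0 <= i < t) Q ^+ (i * m)).
Proof.
move=> m_gt0; rewrite -(big_mkord (fun i => i < t)%N (fun i => Q ^+ (i * m))).
rewrite (@big_nat_widen _ _ _ 0 n.+1 (n.+1 + t)) ?leq_addr //.
rewrite (@big_nat_widen _ _ _ 0 t (n.+1 + t)) ?leq_addl //=.
rewrite [X in eqmodq _ _ X](bigID (fun i => i < n.+1)%N) /=.
rewrite -[X in eqmodq _ X _]addr0; apply: eqmodqD => //; apply: eqmodq_sym.
apply: eqmodq_sum0 => i /andP[_]; rewrite -leqNgt => ni _.
by rewrite -[Q ^+ _]mul1r; apply: eqmodqMqn; apply: leq_trans ni _; apply: leq_pmulr.
Qed.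

Lemma geom_sum t m :
  (1 - Q ^+ m) * (\sum_(0 <= i < t) Q ^+ (i * m)) = 1 - Q ^+ (m * t).
Proof.
rewrite exprM -[X in _ = X]opprB subrX1 -mulNr opprB; congr (_ * _).
by rewrite big_mkord; apply: eq_bigr => i _; rewrite mulnC exprM.
Qed.

(** Modulo [q^(n+1)] each part [m] not divisible by [l] contributes the factor
    [(1 - q^(t m)) / (1 - q^m)] per color. The product of the [1 - q^(r m)] over
    such [m] is [E_r / E_(l r)], used for [r = t] and [r = 1]. *)
Lemma RD_gf k l t : (0 < l)%N -> (0 < t)%N ->
  Fps (fun n => (RD k l t n)%:R) = (E l * E t / (E 1 * E (l * t))) ^+ k.
Proof.
move=> l_gt0 t_gt0; apply/fpsP => n /=.
rewrite RD_coef; set F := \prod_x _.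
have uE : E 1 * E (l * t) \is a GRing.unit by rewrite unitrM !unit_E.
suff: eqmodq n.+1 F ((E l * E t / (E 1 * E (l * t))) ^+ k) by apply.
pose A := \prod_(1 <= m < n.+1 | ~~ (l %| m)%N) \sum_(0 <= i < t) Q ^+ (i * m).
have FA : eqmodq n.+1 F (A ^+ k).
  have -> : A ^+ k = \prod_(x : 'I_k * 'I_n) if (l %| x.2.+1)%N then 1 else
       \sum_(0 <= i < t) Q ^+ (i * x.2.+1).
    rewrite -(pair_bigA _ (fun (_ : 'I_k) (j : 'I_n) =>
      if (l %| j.+1)%N then 1 else \sum_(0 <= i < t) Q ^+ (i * j.+1))) /=.
    rewrite prodr_const card_ord; congr (_ ^+ _).
    rewrite /A big_add1 big_mkcond big_mkord /=.
    by apply: eq_bigr => j _; case: (l %| _)%N.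
  apply: eqmodq_prod => x _ _; case: ifP => lx /=; last exact: sum_geom_trunc.
  (* As t > 0, the multiplicity 0 is allowed, and it is the only one. *)
  rewrite (big_pred1 ord0) // => i; rewrite /= -val_eqE /=.
  by case: eqP => //= ->.
apply: eqmodq_trans FA _; apply: eqmodqX.
rewrite -[A](mulrK uE); apply: eqmodqM => //.
pose D r := \prod_(1 <= m < n.+1 | ~~ (l %| m)%N) (1 - Q ^+ (m * r)).
have AD : D 1%N * A = D t.
  by rewrite -big_split /=; apply: eq_bigr => m _; rewrite muln1 geom_sum.
have e1 := @E_coprime l 1 n l_gt0 isT; have et := @E_coprime l t n l_gt0 t_gt0.
rewrite muln1 in e1.
have e1' := eqmodqM (eqmodq_sym e1) (@eqmodq_refl _ n.+1 (E (l * t))).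
apply: eqmodq_trans (eqmodqM (@eqmodq_refl _ _ A) e1') _.
rewrite -/(D 1%N).
have -> : A * (D 1%N * E l * E (l * t)) = E l * (D t * E (l * t)).
  by rewrite -AD; ring.
exact: eqmodqM.
Qed.

(** * The two progressions *)

(** Multiplying the generating function by [E_1^3 * E1cube_conj * E_9^3 = E_3^12]
    clears the only denominator that is not a series in [q^3]. *)
Lemma RD_sec3_2 :
  sec 3 2 (Fps (fun n => (RD 3 3 27 n)%:R)) =
   9 * (E 3 / E 1) ^+ 9 * (E 9 / E 27) ^+ 3.
Proof.
rewrite RD_gf //; set G := _ ^+ 3.
have eG : G * E 1 ^+ 3 * E 81 ^+ 3 = (E 3 * E 27) ^+ 3.
  by rewrite -exprMn -exprMn -mulrA divrK // unitrM !unit_E.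
have eG2 : infl 3 (E 27 ^+ 3 * E 1 ^+ 12) * G =
    infl 3 (E 1 ^+ 3 * E 9 ^+ 3 * E 3 ^+ 3) * E1cube_conj.
  rewrite inflM // infl_E27X infl_E1X.
  rewrite inflM // infl_E3X [infl 3 (_ * E 9 ^+ 3)]inflM // infl_E1X infl_E9X.
  rewrite -E1cube_conjE -exprMn -eG; ring.
have := congr1 (sec 3 2) eG2; rewrite !sec_inflM //.
have [_ _ ->] := sec_dissected (E1cube0 ^+ 2) (3 * E1cube0 * E 3 ^+ 3) (9 * E 3 ^+ 6).
move: (sec 3 2 G) => s es.
have u : E 27 ^+ 3 * E 1 ^+ 12 \is a GRing.unit by rewrite unitrM !unitrX // unit_E.
apply: (mulrI u); rewrite {}es.
have := divrK (unit_E 1) (E 3); have := divrK (unit_E 27) (E 9).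
by move: (_ / _) (_ / _) => v w <- <-; ring.
Qed.

(** The remaining manipulations of quotients use only the relations among the
    series, so they are carried out for arbitrary ring elements: [a, b, c, d]
    stand for [E 1, E 3, E 9, E 27], [B] for [E1cube_conj], [th] for [E1cube0]. *)
Section Elimination.
Variable A : comUnitRingType.
Implicit Types q th a b c d s B H : A.

Lemma elim_conj_cube a b c d B H :
  a \is a GRing.unit -> d \is a GRing.unit -> a ^+ 3 * B * c ^+ 3 = b ^+ 12 ->
  H = 9 * (b / a) ^+ 9 * (c / d) ^+ 3 ->
  d ^+ 3 * b ^+ 36 * H = 9 * b ^+ 9 * c ^+ 3 * c ^+ 9 * B ^+ 3.
Proof.
move=> ua ud hB eH.
have {}eH : H * d ^+ 3 * a ^+ 9 = 9 * b ^+ 9 * c ^+ 3.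
  rewrite {}eH; have := divrK ua b; have := divrK ud c.
  by move: (b / a) (c / d) => v w <- <-; ring.
have -> : b ^+ 36 = (b ^+ 12) ^+ 3 by rewrite -exprM.
by rewrite -eH -hB; ring.
Qed.

Lemma elim_E1cube0 q th a b c s :
  a \is a GRing.unit -> c \is a GRing.unit ->
  (th ^+ 3 - 27 * q * b ^+ 9) * b ^+ 3 = a ^+ 12 ->
  c ^+ 3 * a ^+ 36 * s = 9 * a ^+ 9 * b ^+ 3 * b ^+ 9 *
    (th ^+ 6 + 189 * th ^+ 3 * q * b ^+ 9 + 729 * q ^+ 2 * b ^+ 18) ->
  s = \sum_(1 <= i < 4)
        (y2 i)%:R * q ^+ (i - 1)
        * (b ^+ (3 * (4 * i - 2)) / c ^+ (3 * (4 * i - 2)))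
        * (c ^+ 3 / a ^+ 3) ^+ (4 * i - 3).
Proof.
move=> ua uc hth es.
have {th hth}es : c ^+ 3 * a ^+ 36 * s = 9 * a ^+ 9 *
   (a ^+ 24 * b ^+ 6 + 243 * q * a ^+ 12 * b ^+ 18 + 6561 * q ^+ 2 * b ^+ 30).
  have -> : a ^+ 24 = (a ^+ 12) ^+ 2 by rewrite -exprM.
  by rewrite es -hth; ring.
have u : c ^+ 3 * a ^+ 36 \is a GRing.unit by rewrite unitrM !unitrX.
apply: (mulrI u); rewrite {}es {u}.
(* The weights stay powers of 3, so that 3 ^ 10 is never expanded in unary. *)
have [y1 y2' y3] : [/\ (y2 1)%:R = 3 ^+ 2 :> A, (y2 2)%:R = 3 ^+ 7 :> A
    & (y2 3)%:R = 3 ^+ 10 :> A].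
  by split; rewrite -natrX.
rewrite (big_ltn (isT : 1 < 4)%N) (big_ltn (isT : 2 < 4)%N) (big_ltn (isT : 3 < 4)%N).
rewrite (big_geq (isT : 4 <= 4)%N) y1 y2' y3.
rewrite -![_ ^+ (3 * _) / _]expr_div_n -![_ ^+ 3 / _]expr_div_n.
rewrite -[(3 * (4 * 1 - 2))%N]/6%N -[(3 * (4 * 2 - 2))%N]/18%N -[(3 * (4 * 3 - 2))%N]/30%N.
rewrite -[(4 * 1 - 3)%N]/1%N -[(4 * 2 - 3)%N]/5%N -[(4 * 3 - 3)%N]/9%N.
rewrite -[(1 - 1)%N]/0%N -[(2 - 1)%N]/1%N -[(3 - 1)%N]/2%N.
have := divrK uc b; have := divrK ua c.
by move: (b / c) (c / a) => v w <- <-; ring.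
Qed.
End Elimination.

Lemma RD_sec9_2 :
  sec 3 0 (9 * (E 3 / E 1) ^+ 9 * (E 9 / E 27) ^+ 3) =
    \sum_(1 <= i < 4)
        (y2 i)%:R * 'q ^+ (i - 1)
        * (E 3 ^+ (3 * (4 * i - 2)) / E 9 ^+ (3 * (4 * i - 2)))
        * (E 9 ^+ 3 / E 1 ^+ 3) ^+ (4 * i - 3).
Proof.
pose H := 9 * (E 3 / E 1) ^+ 9 * (E 9 / E 27) ^+ 3.
apply: (elim_E1cube0 (unit_E 1) (unit_E 9) E1cube0_cube).
rewrite -sec0_conj_cube -[X in _ = X]sec_inflM // -[X in X = _]sec_inflM //.
congr (sec 3 0 _).
have iL : infl 3 (E 9 ^+ 3 * E 1 ^+ 36) = E 27 ^+ 3 * E 3 ^+ 36.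
  by rewrite infl3M; congr (_ * _); [exact: infl_E9X | exact: infl_E1X].
have iR : infl 3 (9 * E 1 ^+ 9 * E 3 ^+ 3 * E 3 ^+ 9) =
    9 * E 3 ^+ 9 * E 9 ^+ 3 * E 9 ^+ 9.
  rewrite infl3M; congr (_ * _); last exact: infl_E3X.
  rewrite infl3M; congr (_ * _); last exact: infl_E3X.
  by rewrite infl3M; congr (_ * _); [exact: infl3_nat | exact: infl_E1X].
apply: (etrans (congr1 (fun x => x * H) iL)).
apply: (etrans _ (congr1 (fun x => x * E1cube_conj ^+ 3) (esym iR))).
exact: (elim_conj_cube (unit_E 1) (unit_E 27) E1cube_conjE (erefl H)).
Qed.

Theorem theorem1p3 :
  (Fps (fun n => (RD 3 3 27 (3 * n + 2))%:R) : {fps int})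
    = 9 * (E 3 / E 1) ^+ 9 * (E 9 / E 27) ^+ 3
  /\
  (Fps (fun n => (RD 3 3 27 (9 * n + 2))%:R) : {fps int})
    = \sum_(1 <= i < 4)
        (y2 i)%:R * 'q ^+ (i - 1)
        * (E 3 ^+ (3 * (4 * i - 2)) / E 9 ^+ (3 * (4 * i - 2)))
        * (E 9 ^+ 3 / E 1 ^+ 3) ^+ (4 * i - 3).
Proof.
split; first by rewrite -RD_sec3_2.
apply: etrans RD_sec9_2; rewrite -RD_sec3_2; apply/fpsP => n.
rewrite !fcoef_sec; congr (RD _ _ _ _)%:R.
(* 9 n + 2 = 3 (3 n) + 2: class 0 modulo 3 inside class 2 modulo 3. *)
by lia.
Qed.
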